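(* Let $P$ be the transition kernel on $\mathbb{R}$ of the stochastic unit root process $\Phi_{n+1}=\mathbf{1}_{\{U_{n+1}\le g(\Phi_n)\}}\Phi_n+\varepsilon_{n+1}$, i.e. $P(x,A)=g(x)\mathbb{P}(x+\varepsilon_0\in A)+(1-g(x))\mathbb{P}(\varepsilon_0\in A)$, under the assumptions on $g$ and on the noise given in the context, with constants $\kappa\in(0,1)$, $R_0>0$, $z_0>0$ and $\gamma_0\in(0,1]$. Define $\beta$ and $\tau$ as follows: (i) $\beta=\gamma_0\wedge(1-\kappa)$ and $\tau=\kappa$, if $\mathbb{E}[\varepsilon_0]>0$; (ii) $\beta=\gamma_0\wedge(1-\kappa/2)$ and $\tau=\kappa$, if $\mathbb{E}[\varepsilon_0]=0$; (iii) $\beta=\gamma_0$ and $\tau=(1-\gamma_0)\wedge\kappa$, if $\mathbb{E}[\varepsilon_0]<0$. Then there exist $z\in(0,z_0]$, $\delta>0$, $M\ge R_0$, a finite constant $b\ge0$ and a concave nondecreasing differentiable function $\phi:[1,\infty)\to(0,\infty)$ satisfying $$\phi(v)=\delta\,z^{\tau/\beta}\,v\,\{1\vee\log(v)\}^{-\tau/\beta}\quad\text{for all sufficiently large }v,$$ such that, with $V(x):=e^{z x_+^{\beta}}$ and $C:=(-\infty,M]$, $$PV(x)+\phi(V(x))\le V(x)+b\,\mathbf{1}_C(x)\qquad\text{for all }x\in\mathbb{R}.$$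
   Context: $x_+=\max(x,0)$, $a\wedge b=\min(a,b)$, $a\vee b=\max(a,b)$, $PV(x)=\int P(x,dy)V(y)$. Noise: $(\varepsilon_n)_{n\ge0}$ is a sequence of i.i.d. real random variables with $\mathbb{E}\bigl[e^{z_0|\varepsilon_0|^{\gamma_0}}\bigr]<\infty$ for some $z_0>0$ and $\gamma_0\in(0,1]$; $(U_n)_{n\ge1}$ is a sequence of i.i.d. random variables uniform on $[0,1]$, independent of $(\varepsilon_n)$. Assumption on $g$: $g:\mathbb{R}\to[0,1)$ is continuous and there exist $\kappa\in(0,1)$, $c_+(g)>0$, $c_-(g)<1$ and $R_0>0$ such that $1-g(x)\ge c_+(g)x^{-\kappa}$ for all $x\ge R_0$ and $g(x)\le c_-(g)$ for all $x\le R_0$. *)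

(* Defs.v *)
From HB Require Import structures.
From mathcomp Require Import all_boot all_order all_algebra.
From mathcomp Require Import all_classical all_reals all_analysis.
From mathcomp Require Import measurable_realfun.

Set Implicit Arguments.
Unset Strict Implicit.
Unset Printing Implicit Defensive.
Import Order.TTheory GRing.Theory Num.Theory.
Import numFieldNormedType.Exports.

Local Open Scope classical_set_scope.
Local Open Scope ring_scope.

Section probability.
Context d (T : measurableType d) (R : realType) (Pr : probability T R).

Definition mutually_independent (X : nat -> {RV Pr >-> R}) : Prop :=
  forall (J : seq nat) (B : nat -> set R), uniq J ->
    (forall j, j \in J -> measurable (B j)) ->
    Pr (\bigcap_(j in [set` J]) (X j @^-1` B j)) =
    (\prod_(j <- J) Pr (X j @^-1` B j))%E.

Definition identically_distributed (X : nat -> {RV Pr >-> R}) : Prop :=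
  forall (n : nat) (B : set R), measurable B ->
    distribution Pr (X n) B = distribution Pr (X 0%N) B.

Definition iid (X : nat -> {RV Pr >-> R}) : Prop :=
  mutually_independent X /\ identically_distributed X.

Definition sigma_of_seq (X : nat -> {RV Pr >-> R}) : set (set T) :=
  <<s [set A | exists n (B : set R), measurable B /\ A = X n @^-1` B] >>.

Definition independent_seqs (X Y : nat -> {RV Pr >-> R}) : Prop :=
  forall A B, sigma_of_seq X A -> sigma_of_seq Y B ->
    Pr (A `&` B) = (Pr A * Pr B)%E.

Definition uniform01 (X : {RV Pr >-> R}) : Prop :=
  forall B : set R, measurable B ->
    distribution Pr X B = uniform_prob (@ltr01 R) B.

(* [U n] is only used for [n >= 1]; [U 0] is unconstrained. *)
Definition noise_assumption (eps U : nat -> {RV Pr >-> R}) (z0 gamma0 : R)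
    : Prop :=
  let U1 n := U n.+1 in
  [/\ iid eps, ('E_Pr[(fun w => expR (z0 * `|eps 0%N w| `^ gamma0))] < +oo)%E,
      iid U1, (forall n, uniform01 (U1 n)) & independent_seqs eps U1].

Fixpoint sur_process (g : R -> R) (eps U : nat -> {RV Pr >-> R}) (x : R)
    (n : nat) (w : T) : R :=
  if n is m.+1 then
    let y := sur_process g eps U x m w in
    \1_[set u | u <= g y] (U n w) * y + eps n w
  else x.

Definition is_sur_kernel (g : R -> R) (e : {RV Pr >-> R}) (P : R.-pker R ~> R)
    : Prop :=
  forall (x : R) (A : set R), measurable A ->
    P x A = ((g x)%:E * Pr ((fun w => x + e w)%R @^-1` A)
             + (1 - g x)%:E * Pr (e @^-1` A))%E.

End probability.

Section assumptions.
Context (R : realType).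

Definition g_assumption (g : R -> R) (kappa cp cm R0 : R) : Prop :=
  [/\ forall x, 0 <= g x < 1, continuous g,
      forall x, R0 <= x -> cp * x `^ (- kappa) <= 1 - g x
    & forall x, x <= R0 -> g x <= cm].

(* Derivatives are relative to [D]: one-sided at the end points it contains. *)
Definition differentiable_on (D : set R) (f : R -> R) : Prop :=
  forall v, D v ->
    cvg ((fun w => (f w - f v) / (w - v)) @ within D v^').

Definition concave_on (D : set R) (f : R -> R) : Prop :=
  convex_function (E := R^o) D (fun v => - f v).

Definition lyapunov (z beta : R) (x : R) : R :=
  expR (z * Num.max x 0 `^ beta).

End assumptions.

(* The two-term formula of [is_sur_kernel] is the law of one step of the
   recursion started at [x]. *)
Lemma sur_process_law1 d (T : measurableType d) (R : realType)
    (Pr : probability T R) (eps U : nat -> {RV Pr >-> R}) (z0 gamma0 : R)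
    (g : R -> R) (x : R) (A : set R) :
  noise_assumption eps U z0 gamma0 -> 0 <= g x < 1 -> measurable A ->
  Pr (sur_process g eps U x 1 @^-1` A) =
  ((g x)%:E * Pr ((fun w => x + eps 0%N w)%R @^-1` A)
   + (1 - g x)%:E * Pr (eps 0%N @^-1` A))%E.
Proof.
move=> noiseP /andP[g0 g1] mA.
case: noiseP => [[_ ideps] _ _ unif ind].
set E := [set u : R | u <= g x].
have mE : measurable E.
  by rewrite (_ : E = `]-oo, g x]%classic)//; apply/seteqP; split => u /=; rewrite in_itv.
have mxA : measurable ((fun y : R => x + y) @^-1` A).
  have : measurable_fun setT (fun y : R => x + y) by exact: measurable_funD.
  by move=> /(_ measurableT _ mA); rewrite setTI.
have mV i (B : set R) : measurable B -> measurable (eps i @^-1` B).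
  by move=> mB; exact: measurable_funPTI.
have mVU i (B : set R) : measurable B -> measurable (U i @^-1` B).
  by move=> mB; exact: measurable_funPTI.
have PE : Pr (U 1%N @^-1` E) = (g x)%:E.
  have := unif 0%N _ mE; rewrite /distribution /pushforward /= => ->.
  rewrite /uniform_prob integral_uniform_pdf.
  have -> : E `&` `[0, 1] = `[0, g x]%classic.
    apply/seteqP; split => u /=; rewrite !in_itv /= /E /=.
      by move=> [-> /andP[->]].
    by move=> /andP[-> h]; rewrite h (le_trans h (ltW g1)).
  rewrite (eq_integral (fun=> 1%E)); last first.
    move=> u; rewrite inE /= in_itv /= /uniform_pdf => /andP[u0 ug].
    by rewrite u0 (le_trans ug (ltW g1)) subr0 invr1.
  rewrite integral_cst//= lebesgue_measure_itv/= lte_fin mul1e.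
  by case: ltP => [_|h]; [rewrite sube0|have /eqP -> : g x == 0 by rewrite eq_le h g0].
have key (B E' : set R) : measurable B -> measurable E' ->
    Pr (eps 1%N @^-1` B `&` U 1%N @^-1` E') =
    (Pr (eps 0%N @^-1` B) * Pr (U 1%N @^-1` E'))%E.
  move=> mB mE'; rewrite ind.
  - by have := ideps 1%N B mB; rewrite /distribution /pushforward => ->.
  - by apply: sub_gen_smallest; exists 1%N, B.
  - by apply: sub_gen_smallest; exists 0%N, E'.
have PEC : Pr (U 1%N @^-1` (~` E)) = (1 - g x)%:E.
  by rewrite preimage_setC (probability_setC _ (mVU 1%N E mE)) PE EFinB.
have -> : sur_process g eps U x 1 @^-1` A =
    (eps 1%N @^-1` ((fun y => x + y) @^-1` A) `&` U 1%N @^-1` E) `|`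
    (eps 1%N @^-1` A `&` U 1%N @^-1` (~` E)).
  apply/seteqP; split => w /=; rewrite indicE; case: (boolP (_ \in _)) => /=.
  - by rewrite inE => h; rewrite mul1r; left.
  - by rewrite notin_setE => h; rewrite mul0r add0r; right.
  - by rewrite inE => h; rewrite mul1r => -[[]//|[_ /(_ h)]].
  - by rewrite notin_setE => h; rewrite mul0r add0r => -[[_ /h]|[]].
rewrite measureU.
- rewrite -PE -PEC [in RHS]muleC [X in _ = (_ + X)%E]muleC.
  by congr (_ + _)%E; apply: key => //; exact: measurableC.
- by apply: measurableI; [exact: mV|exact: mVU].
- by apply: measurableI; [exact: mV|apply: mVU; exact: measurableC].
- by apply/seteqP; split => w //= -[[_ h] [_ /(_ h)]].
Qed.

(* Main.v *)
Require Import Defs.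
From HB Require Import structures.
From mathcomp Require Import all_boot all_order all_algebra.
From mathcomp Require Import all_classical all_reals all_analysis.
From mathcomp Require Import measurable_realfun ring lra.

Set Implicit Arguments.
Unset Strict Implicit.
Unset Printing Implicit Defensive.
Import Order.TTheory GRing.Theory Num.Theory.
Import numFieldNormedType.Exports.
Local Open Scope classical_set_scope.
Local Open Scope ring_scope.

(** Write V for the Lyapunov function and e for the noise.  From a large state
    x the chain either moves to x + e, with probability p = g x, or restarts
    from e, with probability 1 - p >= cp x^(-kappa).

    A restart is a gain: V (e) has a finite mean K, so that for large x the
    restart brings V down from V x to at most V x / 2 on average, which
    contributes -(1 - p) / 2 to the relative drift.

    A move changes V by the factor exp u with
    u = z ((x + e)_+^beta - x^beta).  Concavity of the power gives
    u <= z beta x^(beta - 1) e + z x^(beta - 2) e^2 and |u| <= z x^(beta - 1) |e|,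
    and subadditivity gives u <= z |e|^beta.  Inserted in
    exp u <= 1 + u + u^2 exp (u_+), these bound the mean relative increment by
    [drift_factor]: the first-order term z beta x^(beta - 1) E[e], plus
    (z x^(beta - 2) + z^2 x^(2 beta - 2)) K.  The constant K is a multiple of
    the assumed exponential moment and, as long as z <= z0 / 2, does not depend
    on z ([noise_domination]).  This uniformity is what leaves z free to be
    chosen small afterwards.

    If E[e] > 0 or E[e] = 0, the exponent beta is such that each nonzero term of
    the drift factor is O(x^(-kappa)), and each term carries a factor z.  A
    small z makes the move cost less than half of the restart gain
    ([drift_restart_dominates]).  If E[e] < 0, the first-order term is negative
    and dominates the others for z small and x large, so moves and restarts
    both gain; the better of the orders x^(beta - 1) and x^(-kappa) survives
    ([drift_negative_mean]).

    Since ln (V x) = z x^beta, a relative gain of delta x^(-tau) is exactly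
    phi (V x) with phi v = delta z^q v (ln v)^(-q) and q = tau / beta.  This
    function is concave and increasing only for large v; replacing it to the
    left of exp (q + 2) by its tangent line at that point keeps it concave,
    differentiable, increasing and positive down to v = 1
    ([concave_rate_function]).  On the bounded side x <= M everything is bounded
    and absorbed in b. *)

(** * Powers, exponentials and the pointwise drift *)

Section real_inequalities.
Context {R : realType}.
Implicit Types (u w x y a t e beta gamma z m K : R).

(** The remainder carries [expR w] for any bound [w] of [u] and not
    [expR `|u|]: when [u] comes from a large negative jump, [`|u|] is large but
    a harmless [w] exists. *)
Lemma expR_le_quadratic u w : u <= w -> 0 <= w ->
  expR u <= 1 + u + u ^+ 2 * expR w.
Proof.
move=> uw w0.
have e0 := expR_gt0 u.
have h : expR u * (1 - u) <= 1.
  have := expR_ge1Dx (- u).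
  rewrite expRN -(ler_pM2l e0) mulfV ?gt_eqF//; lra.
have [u0|u0] := leP u 0.
  have e1 : 1 <= expR w by rewrite -expR0 ler_expR.
  apply: (@le_trans _ _ (1 + u + u ^+ 2)); last first.
    by rewrite lerD2l ler_peMr// sqr_ge0.
  have p : 0 < 1 - u by lra.
  rewrite -(ler_pM2r p); apply: (le_trans h); nra.
have ew : expR u <= expR w by rewrite ler_expR.
apply: (@le_trans _ _ (1 + u + u ^+ 2 * expR u)); last first.
  by rewrite lerD2l ler_wpM2l// sqr_ge0.
have : expR u * (1 - u) * (1 + u) <= 1 + u by rewrite ler_piMl//; lra.
lra.
Qed.

(** Bernoulli's inequality for a concave power.  Writing y = exp t, it is the
    convex combination, with weights beta and 1 - beta, of the tangent
    inequalities of exp at beta t, evaluated at t and at 0. *)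
Lemma powR_le_tangent y beta : 0 < beta <= 1 -> 0 <= y ->
  y `^ beta <= 1 + beta * (y - 1).
Proof.
move=> /andP[b0 b1] y0.
have [->|yn0] := eqVneq y 0; first by rewrite powR0 ?gt_eqF//; lra.
rewrite /powR (negbTE yn0).
have yp : 0 < y by rewrite lt_def yn0.
set t := ln y.
have -> : y = expR t by rewrite lnK.
have e0 := expR_gt0 (beta * t).
have h1 : expR (beta * t) * (1 + (1 - beta) * t) <= expR t.
  have -> : expR t = expR (beta * t) * expR ((1 - beta) * t).
    by rewrite -expRD; congr expR; ring.
  apply: ler_wpM2l; [exact: ltW|exact: expR_ge1Dx].
have h2 : expR (beta * t) * (1 - beta * t) <= 1.
  have := expR_ge1Dx (- (beta * t)).
  rewrite expRN -(ler_pM2l e0) mulfV ?gt_eqF//; lra.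
have h3 := ler_wpM2l (ltW b0) h1.
have b1' : 0 <= 1 - beta by lra.
have h4 := ler_wpM2l b1' h2.
lra.
Qed.

Lemma powR_sub1_le y beta : 0 < beta <= 1 -> 0 <= y ->
  `|y `^ beta - 1| <= `|y - 1|.
Proof.
move=> b01 y0; have /andP[b0 b1] := b01.
have [y1|y1] := leP 1 y.
  have h := @powR_le_tangent _ _ b01 y0.
  have h1 : 1 <= y `^ beta.
    by rewrite -[leLHS](powRr0 y); apply: ler_powR => //; exact: ltW.
  rewrite !ger0_norm ?subr_ge0//.
  have : beta * (y - 1) <= y - 1 by rewrite ler_piMl// subr_ge0.
  lra.
have h1 : y `^ beta <= 1.
  have := @powR_le_tangent _ _ b01 y0.
  have : beta * (y - 1) <= 0 by apply: mulr_ge0_le0; lra.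
  lra.
have h2 : y <= y `^ beta.
  have [->|yn0] := eqVneq y 0; first by rewrite powR_ge0.
  by rewrite ger1_powR// lt_def yn0 y0 ltW.
rewrite !ler0_norm; lra.
Qed.

(** After scaling by the larger of the two numbers, with s in [0, 1] their
    ratio: (1 + s)^beta <= 1 + beta s <= 1 + s <= 1 + s^beta. *)
Lemma powR_subadditive x y beta : 0 < beta <= 1 -> 0 <= x -> 0 <= y ->
  (x + y) `^ beta <= x `^ beta + y `^ beta.
Proof.
move=> b01; have /andP[b0 b1] := b01.
wlog yx : x y / y <= x.
  move=> H x0 y0; have [|/ltW] := leP y x; first by move/H; apply.
  by move=> /H /(_ y0 x0); rewrite addrC [leRHS]addrC.
move=> x0 y0.
have [xz|xn0] := eqVneq x 0.
  have -> : y = 0 by apply/eqP; rewrite eq_le y0 -xz yx.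
  by rewrite addr0 lerDl powR_ge0.
have xp : 0 < x by rewrite lt_def xn0.
have s0 : 0 <= y / x by rewrite divr_ge0.
have s1 : y / x <= 1 by rewrite ler_pdivrMr// mul1r.
have -> : x + y = x * (1 + y / x) by field.
have -> : y `^ beta = x `^ beta * (y / x) `^ beta.
  by rewrite -powRM//; congr powR; field.
rewrite powRM//; last by rewrite addr_ge0.
rewrite -[X in _ <= X + _]mulr1 -mulrDr ler_wpM2l ?powR_ge0//.
have h := @powR_le_tangent (1 + y / x) beta b01 ltac:(lra).
have h2 : y / x <= (y / x) `^ beta.
  have [->|yn0] := eqVneq (y / x) 0; first by rewrite powR_ge0.
  by rewrite ger1_powR// lt_def yn0 s0.
have : beta * (y / x) <= y / x by rewrite ler_piMl.
lra.
Qed.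

(** With p = 2 / gamma, t^2 = exp (p ln (t^gamma)), and ln y <= y at
    y = (a / p) t^gamma bounds the exponent by a t^gamma - p ln (a / p). *)
Lemma sqr_le_expR_powR a gamma : 0 < a -> 0 < gamma ->
  exists2 K : R, 0 <= K & forall t, 0 <= t -> t ^+ 2 <= K * expR (a * t `^ gamma).
Proof.
move=> a0 g0.
pose p := 2 / gamma; pose c := a / p.
have p0 : 0 < p by rewrite divr_gt0.
have c0 : 0 < c by rewrite divr_gt0.
exists (expR (- (p * ln c))); first exact: expR_ge0.
move=> t t0; have [->|tn0] := eqVneq t 0.
  by rewrite expr0n mulr_ge0 ?expR_ge0.
have tp : 0 < t by rewrite lt_def tn0.
have tg : 0 < t `^ gamma by rewrite powR_gt0.
have ctg : 0 < c * t `^ gamma by rewrite mulr_gt0.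
have -> : t ^+ 2 = expR (2 * ln t) by rewrite expRM_natl lnK.
rewrite -expRD ler_expR.
have h := ln_sublinear ctg.
rewrite lnM// ln_powR in h.
have -> : 2 * ln t = p * (gamma * ln t) by rewrite /p; field; rewrite gt_eqF.
have -> : a * t `^ gamma = p * (c * t `^ gamma).
  by rewrite /c; field; rewrite gt_eqF.
rewrite -mulrN -mulrDr ler_wpM2l ?ltW//; lra.
Qed.

Lemma max0D_le x e : Num.max (x + e) 0 <= Num.max x 0 + `|e|.
Proof.
rewrite ge_max addr_ge0 ?le_max ?lexx ?orbT//= andbT lerD ?le_max ?lexx//.
exact: ler_norm.
Qed.

Lemma lyapunov_shift_le z beta x e : 0 <= z -> 0 < beta <= 1 ->
  lyapunov z beta (x + e) <= lyapunov z beta x * expR (z * `|e| `^ beta).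
Proof.
move=> z0 b01; have /andP[b0 b1] := b01.
have m0 y : 0 <= Num.max y 0 by rewrite le_max lexx orbT.
rewrite /lyapunov -expRD ler_expR -mulrDr ler_wpM2l//.
apply: (le_trans _ (@powR_subadditive _ _ _ b01 (m0 x) (normr_ge0 e))).
by apply: ge0_ler_powR; rewrite ?nnegrE ?addr_ge0// ?max0D_le// ltW.
Qed.

Lemma max0_powR_le_quadratic beta a : 0 < beta <= 1 ->
  Num.max (1 + a) 0 `^ beta - 1 <= beta * a + a ^+ 2.
Proof.
move=> b01; have /andP[b0 b1] := b01.
have [h|h] := leP (1 + a) 0.
  by rewrite powR0 ?gt_eqF//; nra.
have := powR_le_tangent b01 (ltW h); have := sqr_ge0 a; lra.
Qed.

Lemma sqr_max0_powR_le beta a : 0 < beta <= 1 ->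
  (Num.max (1 + a) 0 `^ beta - 1) ^+ 2 <= a ^+ 2.
Proof.
move=> b01; set y := Num.max _ _.
have y0 : 0 <= y by rewrite le_max lexx orbT.
have ya : `|y - 1| <= `|a|.
  rewrite /y; have [h|h] := leP (1 + a) 0; last by rewrite addrAC subrr add0r.
  rewrite sub0r normrN normr1; have := ler_norm (- a); rewrite normrN; lra.
rewrite -[leLHS]real_normK ?num_real// -[leRHS]real_normK ?num_real//.
by rewrite lerXn2r ?nnegrE// (le_trans (powR_sub1_le b01 y0)).
Qed.

(** Upper bound for the relative increment of the Lyapunov function when the
    chain moves by a jump from [x].  It is linear in the pair [(m, K)]: for a
    given jump [m] is the jump and [K] dominates the remainder, and averaging
    over the jump replaces both by their means. *)
Definition drift_factor z beta m K x : R :=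
  z * beta * x `^ (beta - 1) * m +
  (z * x `^ (beta - 2) + z ^+ 2 * x `^ (2 * beta - 2)) * K.

(** With y = (1 + e / x)_+, the increment of the exponent is
    u = z x^beta (y^beta - 1).  The term z x^(beta - 2) e^2 is there for the
    jumps e < -x, for which u = - z x^beta lies above the linear term when
    |e| is large; the term z^2 x^(2 beta - 2) e^2 bounds u^2. *)
Lemma lyapunov_drift_pointwise z beta x e : 0 <= z -> 0 < beta <= 1 -> 0 < x ->
  lyapunov z beta (x + e) <= lyapunov z beta x *
    (1 + drift_factor z beta e ((1 + e ^+ 2) * expR (z * `|e| `^ beta)) x).
Proof.
move=> z0 b01 x0.
have xn0 : x != 0 by rewrite gt_eqF.
have E1 : x `^ (beta - 1) = x `^ beta / x.
  by rewrite powRB ?xn0 ?implybT// powRr1// ltW.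
have E2 : x `^ (beta - 2) = x `^ beta / x ^+ 2.
  by rewrite powRB ?xn0 ?implybT// powR_mulrn// ltW.
have E3 : x `^ (2 * beta - 2) = (x `^ beta) ^+ 2 / x ^+ 2.
  rewrite powRB ?xn0 ?implybT// powR_mulrn ?(ltW x0)//; congr (_ / _).
  by rewrite mulrC powRrM powR_mulrn// powR_ge0.
rewrite /drift_factor E1 E2 E3 -!exprVn {E1 E2 E3}.
have shift := lyapunov_shift_le x e z0 b01.
have inc := max0_powR_le_quadratic (e / x) b01.
have inc2 := sqr_max0_powR_le (e / x) b01.
have VD : lyapunov z beta (x + e) = lyapunov z beta x *
    expR (z * x `^ beta * (Num.max (1 + e / x) 0 `^ beta - 1)).
  have y0 : 0 <= Num.max (1 + e / x) 0 by rewrite le_max lexx orbT.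
  have mE : Num.max (x + e) 0 = x * Num.max (1 + e / x) 0.
    rewrite maxr_pMr ?(ltW x0)// mulr0; congr Num.max.
    by rewrite mulrDr mulr1 mulrCA mulfV// mulr1.
  rewrite /lyapunov mE [Num.max x 0]max_l ?(ltW x0)//.
  move: (Num.max (1 + e / x) 0) y0 => y y0 {mE}.
  by rewrite (powRM _ (ltW x0) y0) -expRD mulrBr mulr1 addrC subrK mulrA.
have xb0 : 0 <= z * x `^ beta by rewrite mulr_ge0 ?powR_ge0.
move: shift; rewrite VD {VD} !ler_pM2l ?expR_gt0// ler_expR => uw.
have w0 : 0 <= z * `|e| `^ beta by rewrite mulr_ge0 ?powR_ge0.
have ew : 1 <= expR (z * `|e| `^ beta) by rewrite -[leLHS]expR0 ler_expR.
apply: (le_trans (expR_le_quadratic uw w0)).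
have {inc} ule := ler_wpM2l xb0 inc.
have {inc2} u2 := ler_wpM2l (sqr_ge0 (z * x `^ beta)) inc2.
have i2 : 0 <= x^-1 ^+ 2 by exact: sqr_ge0.
move: x^-1 (x `^ beta) (expR (z * `|e| `^ beta))
  (Num.max (1 + e / x) 0 `^ beta - 1) xb0 ule u2 ew i2 => i X W r.
rewrite !exprMn => xb0 ule u2 ew i2.
have e2 := sqr_ge0 e.
have Y1 : e ^+ 2 <= (1 + e ^+ 2) * W by rewrite (le_trans _ (ler_peMr _ ew)); lra.
have Y2 : e ^+ 2 * W <= (1 + e ^+ 2) * W.
  by rewrite ler_wpM2r ?lerDr// (le_trans _ ew).
have c1 : 0 <= z * X * i ^+ 2 by rewrite mulr_ge0.
have c2 : 0 <= z ^+ 2 * X ^+ 2 * i ^+ 2 by rewrite -!exprMn sqr_ge0.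
have h1 := ler_wpM2l c1 Y1.
have h2 := ler_wpM2l c2 Y2.
have W0 : 0 <= W by exact: le_trans ew.
have h3 := ler_wpM2r W0 u2.
clear -ule h1 h2 h3; lra.
Qed.

End real_inequalities.

(** * Relative drift for small z *)

Section drift.
Context {R : realType}.
Implicit Types (beta kappa tau cp m K x z delta : R).

(** The relative form, after division by V x, of the drift inequality on
    the half-line from [x0]: [p] stands for the probability [g x] of a move,
    and 1 / 2 bounds the mean of V after a restart divided by V x. *)
Definition relative_drift kappa cp beta tau m K z delta x0 :=
  forall x p, x0 <= x -> 0 <= p < 1 -> cp * x `^ (- kappa) <= 1 - p ->
    p * (1 + drift_factor z beta m K x) + (1 - p) / 2 <=
      1 - delta * x `^ (- tau).

(** The drift factor is at most z (|m| + 2 K) x^(-kappa) for x >= 1 and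
    z <= 1.  Half of the restart gain (1 - p) / 2 is at least
    (cp / 4) x^(-kappa): choosing z so that the drift factor stays below
    this half leaves delta = cp / 4. *)
Lemma drift_restart_dominates z0 beta kappa cp m K :
  0 < z0 -> 0 < beta <= 1 -> 0 < cp -> 0 <= K ->
  beta <= 1 - kappa / 2 -> (m = 0 \/ beta <= 1 - kappa) -> 0 <= kappa ->
  exists z delta x0 : R, [/\ 0 < z <= z0, 0 < delta &
    relative_drift kappa cp beta kappa m K z delta x0].
Proof.
move=> z00 /andP[b0 b1] cp0 K0 bk2 hm k0.
pose D := `|m| + 2 * K + 1.
have D0 : 0 < D by rewrite /D; have := normr_ge0 m; lra.
pose z := Num.min (Num.min z0 1) (cp / (4 * D)).
have z_gt0 : 0 < z by rewrite !lt_min z00 ltr01 divr_gt0// mulr_gt0.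
have z_le : z <= z0 by rewrite !ge_min lexx.
have z_le1 : z <= 1 by rewrite !ge_min lexx orbT.
have zD : z * (4 * D) <= cp.
  by rewrite -ler_pdivlMr ?mulr_gt0// ge_min lexx orbT.
exists z, (cp / 4), 1; split; [by rewrite z_gt0 z_le|lra|].
move=> x p x1 /andP[p0 p1] hp.
set X := x `^ (- kappa) in hp *.
have X0 : 0 <= X by exact: powR_ge0.
have E1 : x `^ (beta - 2) <= X by apply: ler_powR => //; lra.
have E2 : x `^ (2 * beta - 2) <= X by apply: ler_powR => //; lra.
have E3 : beta * x `^ (beta - 1) * m <= X * `|m|.
  have [->|h] := hm; first by rewrite normr0 !mulr0.
  have F1 : x `^ (beta - 1) <= X by apply: ler_powR => //; lra.
  have F2 := powR_ge0 x (beta - 1).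
  apply: (@le_trans _ _ (beta * x `^ (beta - 1) * `|m|)).
    by apply: ler_wpM2l; [rewrite mulr_ge0// ltW|exact: ler_norm].
  apply: ler_wpM2r => //; nra.
have A : drift_factor z beta m K x <= z * D * X.
  rewrite /drift_factor.
  have G1 : z * (beta * x `^ (beta - 1) * m) <= z * (X * `|m|).
    by apply: ler_wpM2l => //; exact: ltW.
  have G2 : z * x `^ (beta - 2) + z ^+ 2 * x `^ (2 * beta - 2) <= z * X + z * X.
    apply: lerD; first by apply: ler_wpM2l => //; exact: ltW.
    apply: ler_pM => //; [exact: sqr_ge0|exact: powR_ge0|].
    by rewrite expr2 ger_pMl.
  have G3 := ler_wpM2r K0 G2.
  have G4 : 0 <= z * X by rewrite mulr_ge0// ltW.
  rewrite /D; lra.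
have zDX : z * D * X <= cp / 4 * X by apply: ler_wpM2r => //; lra.
have : p * drift_factor z beta m K x <= cp / 4 * X.
  have : 0 <= cp / 4 * X by rewrite mulr_ge0//; lra.
  nra.
lra.
Qed.

(** With c = - beta m > 0, the drift factor is at most
    x^(beta - 1) z (- c + (1 / x + z) K), hence at most
    - (z c / 2) x^(beta - 1) once both z K and K / x are below c / 4.  The
    average over p of this gain and of the restart gain 1 / 2 is of order
    x^(beta - 1) for every p, since x^(beta - 1) <= 1; the restart gain alone is
    of order x^(-kappa). *)
Lemma drift_negative_mean z0 beta kappa cp m K :
  0 < z0 -> 0 < beta <= 1 -> 0 < cp -> 0 <= K -> m < 0 ->
  exists z delta x0 : R, [/\ 0 < z <= z0, 0 < delta &
    relative_drift kappa cp beta (Num.min (1 - beta) kappa) m K z delta x0].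
Proof.
move=> z00 /andP[b0 b1] cp0 K0 m0.
pose c := - (beta * m).
have c0 : 0 < c by rewrite /c -mulrN mulr_gt0//; lra.
pose z := Num.min z0 (c / (4 * (K + 1))).
have z_gt0 : 0 < z by rewrite !lt_min z00 divr_gt0//; lra.
have z_le : z <= z0 by rewrite !ge_min lexx.
have zK : z * (4 * (K + 1)) <= c.
  by rewrite -ler_pdivlMr ?ge_min ?lexx ?orbT//; lra.
pose x0 := Num.max 1 (4 * (K + 1) / c).
have zc0 : 0 < z * c by rewrite mulr_gt0.
pose delta := Num.min (Num.min (z * c / 2) (1 / 2)) (cp / 2).
exists z, delta, x0; split.
- by rewrite z_gt0 z_le.
- rewrite !lt_min; apply/andP; split; last lra.
  by apply/andP; split; lra.
move=> x p xx0 /andP[p0 p1] hp.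
have d1 : delta <= z * c / 2 by rewrite !ge_min lexx.
have d2 : delta <= 1 / 2 by rewrite !ge_min lexx orbT.
have d3 : delta <= cp / 2 by rewrite !ge_min lexx orbT.
have x1 : 1 <= x by apply: (le_trans _ xx0); rewrite le_max lexx.
have xp : 0 < x by lra.
have xK : 4 * (K + 1) <= c * x.
  rewrite [c * x]mulrC -ler_pdivrMr//; apply: (le_trans _ xx0).
  by rewrite le_max lexx orbT.
set Y := x `^ (beta - 1).
have Y0 : 0 <= Y by exact: powR_ge0.
have Y1 : Y <= 1 by rewrite -(powRr0 x); apply: ler_powR => //; lra.
have xn0 : x != 0 by rewrite gt_eqF.
have E1 : x `^ (beta - 2) = Y / x.
  have -> : beta - 2 = beta - 1 - 1 by lra.
  by rewrite powRB ?xn0 ?implybT// powRr1// ltW.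
have E2 : x `^ (2 * beta - 2) <= Y by apply: ler_powR => //; lra.
have A : drift_factor z beta m K x <= - (z * c / 2) * Y.
  rewrite /drift_factor -/Y E1.
  have G1 : x^-1 * K <= c / 4.
    rewrite mulrC ler_pdivrMr//; lra.
  have G2 : z * x `^ (2 * beta - 2) * K <= Y * (c / 4).
    apply: (@le_trans _ _ (z * Y * K)).
      by apply: ler_wpM2r => //; apply: ler_wpM2l => //; exact: ltW.
    rewrite (_ : z * Y * K = Y * (z * K)); last by ring.
    apply: ler_wpM2l => //; lra.
  have G3 := ler_wpM2l Y0 G1.
  have G4 := ler_wpM2l (ltW z_gt0) (lerD G3 G2).
  rewrite /c in G4 *; lra.
(* the order x^(beta - 1), from moves and restarts together *)
have H1 : p * (1 + drift_factor z beta m K x) + (1 - p) / 2 <= 1 - delta * Y.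
  have := ler_wpM2l p0 A.
  have K1 : delta * (p * Y) <= z * c / 2 * (p * Y).
    by apply: ler_wpM2r => //; rewrite mulr_ge0.
  have p1' : 0 <= 1 - p by lra.
  have d0 : 0 <= delta.
    by rewrite !le_min divr_ge0 ?(ltW zc0)// divr_ge0//= divr_ge0// ltW.
  have K2 : (1 - p) * (delta * Y) <= (1 - p) * (1 / 2).
    by apply: ler_wpM2l => //; nra.
  lra.
(* the order x^(-kappa), from restarts only *)
have H2 : p * (1 + drift_factor z beta m K x) + (1 - p) / 2 <=
    1 - delta * x `^ (- kappa).
  have X0 := powR_ge0 x (- kappa).
  have := ler_wpM2l p0 A.
  have : 0 <= p * (z * c / 2 * Y) by rewrite !mulr_ge0// ltW.
  have : delta * x `^ (- kappa) <= cp / 2 * x `^ (- kappa) by apply: ler_wpM2r.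
  lra.
have [h|h] := leP (1 - beta) kappa; last exact: H2.
by rewrite opprB.
Qed.

Lemma drift_cases z0 gamma0 kappa cp m K beta tau :
  0 < z0 -> 0 < gamma0 <= 1 -> 0 < kappa < 1 -> 0 < cp -> 0 <= K ->
  [\/ [/\ 0 < m, beta = Num.min gamma0 (1 - kappa) & tau = kappa],
      [/\ m = 0, beta = Num.min gamma0 (1 - kappa / 2) & tau = kappa]
    | [/\ m < 0, beta = gamma0 & tau = Num.min (1 - gamma0) kappa]] ->
  [/\ 0 < beta <= gamma0, 0 <= tau &
    exists z delta x0 : R, [/\ 0 < z <= z0, 0 < delta &
      relative_drift kappa cp beta tau m K z delta x0]].
Proof.
move=> z00 /andP[g0 g1] /andP[k0 k1] cp0 K0.
case=> [[_ bE ->]|[m0 bE ->]|[m0 -> ->]].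
- have bg : 0 < beta <= gamma0.
    by rewrite bE lt_min g0 ge_min lexx/= andbT; lra.
  have bk : beta <= 1 - kappa by rewrite bE ge_min lexx orbT.
  split; [by []|exact: ltW|].
  by apply: drift_restart_dominates => //; [lra|lra|by right|exact: ltW].
- have bg : 0 < beta <= gamma0.
    by rewrite bE lt_min g0 ge_min lexx/= andbT; lra.
  have bk : beta <= 1 - kappa / 2 by rewrite bE ge_min lexx orbT.
  split; [by []|exact: ltW|].
  by apply: drift_restart_dominates => //; [lra|by left|exact: ltW].
- split; first by rewrite g0 lexx.
    by rewrite le_min; apply/andP; split; lra.
  by apply: drift_negative_mean => //; rewrite g0.
Qed.

End drift.

(** * A concave rate function *)

Section tangent_extension.
Context {R : realType}.
Implicit Types (f h : R -> R) (a v w : R).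

(** Gluing the tangent line to the left of [a] keeps the concavity and the
    differentiability of [f]; the derivative at [v] becomes
    [h (Num.max v a)] if that of [f] is [h]. *)
Definition tangent_extension f h a v :=
  if v < a then f a + h a * (v - a) else f v.

Lemma concave_tangent f h a v w :
  (forall v, a <= v -> is_derive v 1 f (h v)) ->
  (forall v w, a <= v -> v <= w -> h w <= h v) ->
  a <= v -> a <= w -> f w <= f v + h v * (w - v).
Proof.
move=> fh hanti.
have MV v' w' : a <= v' -> v' < w' ->
    exists2 c, v' <= c <= w' & f w' - f v' = h c * (w' - v').
  move=> av vw.
  have [||c + ->] := @MVT R f h v' w' vw.
  - move=> x; rewrite in_itv/= => /andP[vx _].
    by apply: fh; exact: le_trans (ltW vx).
  - apply: derivable_within_continuous => x; rewrite in_itv/= => /andP[vx _].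
    by have [] := fh x (le_trans av vx).
  rewrite in_itv/= => /andP[vc cw]; exists c => //.
  by rewrite !ltW.
move=> av aw; have [vw|wv|->] := ltgtP v w; last by rewrite subrr mulr0 addr0.
- have [c /andP[vc cw]] := MV v w av vw.
  have hc := hanti _ _ av vc.
  have : h c * (w - v) <= h v * (w - v) by rewrite ler_wpM2r// subr_ge0 ltW.
  lra.
- have [c /andP[wc cv]] := MV w v aw wv.
  have hc := hanti _ _ (le_trans aw wc) cv.
  have : h v * (v - w) <= h c * (v - w) by rewrite ler_wpM2r// subr_ge0 ltW.
  lra.
Qed.

Lemma tangent_extension_tangent f h a v w :
  (forall v, a <= v -> is_derive v 1 f (h v)) ->
  (forall v w, a <= v -> v <= w -> h w <= h v) ->
  tangent_extension f h a w <=
    tangent_extension f h a v + h (Num.max v a) * (w - v).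
Proof.
move=> fh hanti; have T := concave_tangent fh hanti.
rewrite /tangent_extension; have [va|av] := ltP v a; have [wa|aw] := ltP w a.
- lra.
- have := T a w (lexx a) aw; lra.
- have := T v a av (lexx a).
  have : h a * (w - a) <= h v * (w - a).
    by apply: ler_wnM2r; [rewrite subr_le0 ltW|exact: hanti].
  lra.
- exact: T.
Qed.

Lemma concave_on_supergradient (f k : R -> R) a :
  (forall v w, a <= v -> a <= w -> f w <= f v + k v * (w - v)) ->
  concave_on `[a, +oo[ f.
Proof.
move=> fk t x y; rewrite !inE/= !in_itv/= !andbT => xi yi.
set m := conv t _ _.
have mE : m = t%:num * x + (1 - t%:num) * y by [].
have t0 : 0 <= t%:num :> R by [].
have t1 : t%:num <= 1 :> R by [].
clearbody m.
have mi : a <= m by rewrite mE; nra.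
have h1 := ler_wpM2l t0 (fk _ _ mi xi).
have t1' : 0 <= 1 - t%:num :> R by lra.
have h2 := ler_wpM2l t1' (fk _ _ mi yi).
rewrite convRE /unstable.onem.
have : t%:num * (k m * (x - m)) + (1 - t%:num) * (k m * (y - m)) = 0.
  rewrite mE; ring.
lra.
Qed.

Lemma differentiable_on_is_derive (D : set R) (f k : R -> R) :
  (forall v, D v -> is_derive v 1 f (k v)) -> differentiable_on D f.
Proof.
move=> fk v Dv.
have [G [fG cG Gv]] := (is_derive1_caratheodory f v (k v)).1 (fk v Dv).
apply/cvg_ex; exists (G v).
have : G @ within D v^' --> G v.
  apply: cvg_trans cG; apply: cvg_fmap2.
  by apply: cvg_trans; [exact: cvg_within|exact: cvg_within].
apply: cvg_trans; apply: near_eq_cvg.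
rewrite /prop_near1/= /nbhs/= /within/=.
apply: filterS (@nbhs_dnbhs_neq _ v) => w wv _.
by rewrite fG mulfK// subr_eq0.
Qed.

(** Carathéodory's form of differentiability, by a slope function continuous at
    [v], turns the gluing of derivatives at [a] into that of slopes. *)
Lemma tangent_extension_is_derive f h a v :
  (forall v, a <= v -> is_derive v 1 f (h v)) ->
  is_derive v 1 (tangent_extension f h a) (h (Num.max v a)).
Proof.
move=> fh; apply/is_derive1_caratheodory.
have av : a <= Num.max v a by rewrite le_max lexx orbT.
have [G [fG cG Gv]] := (is_derive1_caratheodory f _ _).1 (fh _ av).
have [va|av'] := ltP v a.
  exists (fun w => if w < a then h a else
    (f w - (f a + h a * (v - a))) / (w - v)); split; last by rewrite va.
    move=> w; rewrite /tangent_extension va; case: ltP => [wa|aw]; first by ring.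
    by rewrite mulfVK// subr_eq0 gt_eqF// (lt_le_trans va).
  rewrite /prop_for/continuous_at/= va; apply: cvg_near_cst.
  by near=> w; rewrite ifT//; near: w; exact: lt_nbhsl va.
rewrite (max_l av') in fG cG Gv.
have [va|vna] := eqVneq v a.
  rewrite va in fG cG Gv *.
  exists (fun w => if w < a then h a else G w); split; last by rewrite ltxx.
    move=> w; rewrite /tangent_extension ltxx.
    by case: ltP => // _; ring.
  rewrite /prop_for/continuous_at/= ltxx Gv.
  move: cG; rewrite /prop_for/continuous_at/= Gv => /cvgrPdist_le cG.
  apply/cvgrPdist_le => e e0; near=> w.
  case: ltP => _; first by rewrite subrr normr0 ltW.
  by near: w; exact: cG.
have {vna av'} av' : a < v by rewrite lt_neqAle eq_sym vna.
exists (fun w => if w < a then (f a + h a * (w - a) - f v) / (w - v) else G w).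
split; last by rewrite ltNge (ltW av').
  move=> w; rewrite /tangent_extension [v < a]ltNge (ltW av')/=.
  by case: ltP => // wa; rewrite mulfVK// subr_eq0 lt_eqF// (lt_trans wa).
rewrite /prop_for/continuous_at/= [v < a]ltNge (ltW av')/=.
apply: cvg_trans cG; apply: near_eq_cvg; near=> w.
by rewrite ltNge ltW//; near: w; exact: lt_nbhsr.
Unshelve. all: by end_near. Qed.

End tangent_extension.

Section rate_function.
Context {R : realType}.
Implicit Types c q v w : R.

Lemma is_derive_log_power c q v : 1 < v ->
  is_derive v 1 (fun v : R => c * v * ln v `^ (- q))
    (c * (ln v `^ (- q) * (1 - q / ln v))).
Proof.
move=> v1; have v0 : 0 < v by lra.
have L0 : 0 < ln v by rewrite ln_gt0.
have dp : is_derive v 1 (fun v : R => ln v `^ (- q))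
    (v^-1 * ((- q) * ln v `^ (- q - 1))).
  have dl := is_derive1_ln v0.
  have dq := is_derive1_powR (- q) L0.
  have := is_derive1_comp dq dl.
  by rewrite mulrC.
have di : is_derive v 1 (fun v : R => c * v) c.
  by apply: is_derive_eq; rewrite -[RHS]mulr1.
apply: (is_derive_eq (is_deriveM di dp)).
have Ln0 : ln v != 0 by rewrite gt_eqF.
rewrite /GRing.scale/= powRB ?Ln0 ?implybT// powRr1 ?ltW//.
by field; rewrite !gt_eqF.
Qed.

(** Write L = ln v and s = L / ln w <= 1.  As s^(-q) >= 1 + q (1 - s), it is
    enough that (1 + q (1 - s)) (1 - q / L) >= 1 - (q / L) s, and the difference
    of the two sides is (1 - s) (q - (q / L) (q + 1)), nonnegative as soon as
    L >= q + 1. *)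
Lemma log_power_derivative_antitone q v w :
  0 <= q -> expR (q + 2) <= v -> v <= w ->
  ln w `^ (- q) * (1 - q / ln w) <= ln v `^ (- q) * (1 - q / ln v).
Proof.
move=> q0 av vw.
have v0 : 0 < v by rewrite (lt_le_trans (expR_gt0 _) av).
have Lv : q + 2 <= ln v by rewrite -[q + 2]expRK ler_ln ?posrE ?expR_gt0.
have Lw : ln v <= ln w by rewrite ler_ln ?posrE// (lt_le_trans v0).
move: (ln v) (ln w) Lv Lw => a b qa ab.
have a0 : 0 < a by lra.
have b0 : 0 < b by lra.
pose s := a / b.
have s0 : 0 < s by rewrite divr_gt0.
have s1 : s <= 1 by rewrite /s ler_pdivrMr// mul1r.
have bE : b = a / s by rewrite /s; field; rewrite !gt_eqF.
have pb : 0 < b `^ (- q) by exact: powR_gt0.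
have aE : a `^ (- q) = b `^ (- q) * s `^ (- q).
  rewrite -powRM ?ltW//; congr powR; rewrite /s; field; rewrite !gt_eqF//.
rewrite aE -mulrA ler_wpM2l ?(ltW pb)//.
have hs : 1 + q * (1 - s) <= s `^ (- q).
  rewrite /powR gt_eqF//; apply: le_trans (expR_ge1Dx _).
  have := le_ln1Dx (_ : -1 < s - 1); rewrite addrCA subrr addr0.
  move=> /(_ ltac:(lra)) h; have := ler_wpM2l q0 h; lra.
pose r := q / a.
have rE : q = r * a by rewrite /r; field; rewrite gt_eqF.
have r0 : 0 <= r by rewrite divr_ge0// ltW.
have -> : q / b = r * s by rewrite /r/s; field; rewrite !gt_eqF.
rewrite -/r.
have rq : r * (q + 1) <= q by rewrite {2}rE ler_wpM2l//; lra.
have r1 : 0 <= 1 - r by nra.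
have h := ler_wpM2r r1 hs.
apply: le_trans h.
have : 0 <= (1 - s) * (q - r * (q + 1)) by rewrite mulr_ge0; lra.
lra.
Qed.

(** The threshold exp (q + 2) lies to the right both of exp (q + 1), where the
    function becomes concave, and of exp q, where it becomes increasing.
    Positivity at 1 holds because the tangent line at exp (q + 2) is nonnegative
    at the origin and increases strictly. *)
Lemma concave_rate_function c q : 0 < c -> 0 <= q ->
  exists phi : R -> R,
    [/\ forall v, 1 <= v -> 0 < phi v,
        concave_on `[1, +oo[ phi,
        {in `[1, +oo[ &, {homo phi : v w / v <= w}},
        differentiable_on `[1, +oo[ phi
      & forall v, expR (q + 2) <= v ->
          phi v = c * v * Num.max 1 (ln v) `^ (- q)].
Proof.
move=> c0 q0; pose a := expR (q + 2).
pose f v := c * v * ln v `^ (- q).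
pose h v := c * (ln v `^ (- q) * (1 - q / ln v)).
have a1 : 1 < a by rewrite -expR0 ltr_expR; lra.
have fh v : a <= v -> is_derive v 1 f (h v).
  by move=> av; apply: is_derive_log_power; exact: lt_le_trans av.
have hanti v w : a <= v -> v <= w -> h w <= h v.
  move=> av vw; apply: ler_wpM2l; first exact: ltW.
  exact: log_power_derivative_antitone.
have Lge v : a <= v -> q + 2 <= ln v.
  move=> av; rewrite -[q + 2]expRK ler_ln ?posrE ?expR_gt0//.
  exact: lt_le_trans (expR_gt0 _) av.
have h0 v : a <= v -> 0 <= h v.
  move=> /Lge Lv; rewrite mulr_ge0 ?(ltW c0)// mulr_ge0 ?powR_ge0//.
  rewrite subr_ge0 ler_pdivrMr; lra.
pose phi := tangent_extension f h a.
have T v w : phi w <= phi v + h (Num.max v a) * (w - v).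
  exact: tangent_extension_tangent.
have am v : a <= Num.max v a by rewrite le_max lexx orbT.
have mono v w : v <= w -> phi v <= phi w.
  move=> vw; apply: (le_trans (T w v)).
  by rewrite gerDl mulr_ge0_le0 ?h0// subr_le0.
exists phi; split.
- move=> v v1; apply: lt_le_trans (mono _ _ v1).
  rewrite /phi /tangent_extension a1 /f /h.
  have La := Lge a (lexx a).
  have P0 : 0 < ln a `^ (- q) by apply: powR_gt0; lra.
  have r0 : 0 <= q / ln a by rewrite divr_ge0//; lra.
  have r1 : q / ln a < 1 by rewrite ltr_pdivrMr; lra.
  rewrite (_ : _ + _ =
    c * (ln a `^ (- q) * (a * (q / ln a) + (1 - q / ln a)))); last by ring.
  by rewrite !mulr_gt0//; nra.
- by apply: (concave_on_supergradient (k := fun v => h (Num.max v a))) => *.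
- by move=> v w _ _; exact: mono.
- apply: (differentiable_on_is_derive (k := fun v => h (Num.max v a))) => v _.
  exact: tangent_extension_is_derive.
- move=> v av; rewrite /phi /tangent_extension ltNge av/= /f.
  by rewrite max_r//; have := Lge v av; lra.
Qed.

End rate_function.

(** * Integrals against the noise and the kernel *)

Section kernel_integral.
Context d (T : measurableType d) (R : realType) (Pr : probability T R).

Lemma integral_sur_kernel (g : R -> R) (e : {RV Pr >-> R}) (P : R.-pker R ~> R)
    (x : R) (f : R -> R) :
  is_sur_kernel g e P -> 0 <= g x <= 1 -> measurable_fun setT f ->
  (forall y, 0 <= f y) ->
  (\int[P x]_y (f y)%:E = (g x)%:E * (\int[Pr]_w (f (x + e w)%R)%:E) +
     (1 - g x)%:E * (\int[Pr]_w (f (e w))%:E))%E.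
Proof.
move=> hP /andP[g0 g1] mf f0.
have g1' : 0 <= 1 - g x by rewrite subr_ge0.
have mxe : measurable_fun setT (fun w => x + e w) by exact: measurable_funD.
pose xe : {mfun T >-> R} :=
  HB.pack (fun w => x + e w) (isMeasurableFun.Build _ _ _ _ _ mxe).
pose m1 := mscale (NngNum g0) (distribution Pr xe).
pose m2 := mscale (NngNum g1') (distribution Pr e).
have mEf : measurable_fun setT (EFin \o f) by exact/measurable_EFinP.
have f0' y : (0 <= (EFin \o f) y)%E by rewrite lee_fin.
rewrite (@eq_measure_integral _ _ _ setT (measure_add m1 m2)); last first.
  by move=> A mA _; rewrite hP//; exact/esym/(measure_addE m1 m2).
rewrite (ge0_integral_measure_add _ _ _ _ mEf)//.
rewrite !ge0_integral_mscale//=; first last.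
- by move=> y _; exact: f0'.
- by move=> y _; exact: f0'.
congr (_ * _ + _ * _)%E.
- by rewrite ge0_integral_distribution.
- by rewrite ge0_integral_distribution.
Qed.

End kernel_integral.

Section moments.
Context d (T : measurableType d) (R : realType) (Pr : probability T R).

Lemma measurable_lyapunov (z beta : R) : measurable_fun setT (lyapunov z beta).
Proof.
rewrite /lyapunov; apply: measurableT_comp => //.
apply: measurable_funM => //.
apply: (measurableT_comp (measurable_powR beta)).
exact: measurable_maxr.
Qed.

(** Halving z0 makes room for the polynomial factor 1 + e^2, which is
    absorbed by exp ((z0 / 2) |e|^gamma0); the bound |e|^beta <= 1 + |e|^gamma0
    takes care of beta.  The constant K is common to all z and beta. *)
Lemma noise_domination (z0 gamma0 : R) : 0 < z0 -> 0 < gamma0 <= 1 ->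
  exists2 K : R, 0 <= K & forall z beta e : R,
    0 <= z <= z0 / 2 -> 0 < beta <= gamma0 ->
    (1 + e ^+ 2) * expR (z * `|e| `^ beta) <= K * expR (z0 * `|e| `^ gamma0).
Proof.
move=> z00 /andP[g0 g1].
have [K K0 hK] := @sqr_le_expR_powR R (z0 / 2) gamma0 ltac:(lra) g0.
exists ((1 + K) * expR z0); first by rewrite mulr_ge0 ?expR_ge0//; lra.
move=> z beta e /andP[z_ge0 zz0] /andP[b0 bg].
have G0 : 0 <= `|e| `^ gamma0 by exact: powR_ge0.
have e2 : 1 + e ^+ 2 <= (1 + K) * expR (z0 / 2 * `|e| `^ gamma0).
  have h1 : 1 <= expR (z0 / 2 * `|e| `^ gamma0).
    by rewrite -[leLHS]expR0 ler_expR mulr_ge0//; lra.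
  have := hK _ (normr_ge0 e); rewrite real_normK ?num_real//; lra.
have eb : `|e| `^ beta <= 1 + `|e| `^ gamma0.
  have [h|h] := leP 1 `|e|.
    apply: (le_trans (ler_powR h bg)); lra.
  have [->|en0] := eqVneq `|e| 0; first by rewrite !powR0 ?addr0// gt_eqF.
  have : `|e| `^ beta <= `|e| `^ 0.
    by apply: ger_powR; [rewrite lt_def en0 normr_ge0/= ltW|exact: ltW].
  rewrite powRr0; lra.
have h : expR (z * `|e| `^ beta) <= expR z0 * expR (z0 / 2 * `|e| `^ gamma0).
  rewrite -expRD ler_expR.
  have := ler_wpM2l z_ge0 eb.
  have : z * (1 + `|e| `^ gamma0) <= z0 / 2 * (1 + `|e| `^ gamma0).
    by apply: ler_wpM2r => //; lra.
  lra.
have -> : (1 + K) * expR z0 * expR (z0 * `|e| `^ gamma0) =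
    ((1 + K) * expR (z0 / 2 * `|e| `^ gamma0)) *
    (expR z0 * expR (z0 / 2 * `|e| `^ gamma0)).
  rewrite (_ : z0 * `|e| `^ gamma0 =
    z0 / 2 * `|e| `^ gamma0 + z0 / 2 * `|e| `^ gamma0); last by lra.
  by rewrite expRD; ring.
by apply: ler_pM => //; rewrite ?expR_ge0// addr_ge0 ?sqr_ge0.
Qed.

(** The constants m and K are found before z and beta: the choice of z that
    makes the drift negative depends on them. *)
Lemma expectation_lyapunov_shift (e : {RV Pr >-> R}) (z0 gamma0 : R) :
  0 < z0 -> 0 < gamma0 <= 1 ->
  ('E_Pr[(fun w => expR (z0 * `|e w| `^ gamma0))] < +oo)%E ->
  exists m K : R, [/\ ('E_Pr[e] = m%:E)%E, 0 <= K &
    forall z beta : R, 0 <= z <= z0 / 2 -> 0 < beta <= gamma0 ->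
    (forall x : R, (\int[Pr]_w (lyapunov z beta (x + e w)%R)%:E <=
        (lyapunov z beta x * K)%:E)%E) /\
    (forall x : R, 0 < x -> (\int[Pr]_w (lyapunov z beta (x + e w)%R)%:E <=
        (lyapunov z beta x * (1 + drift_factor z beta m K x))%:E)%E)].
Proof.
move=> z00 g01; have /andP[g0 g1] := g01.
have [K K0 hK] := noise_domination z00 g01.
pose q w := K * expR (z0 * `|e w| `^ gamma0).
have q0 w : 0 <= q w by rewrite mulr_ge0// expR_ge0.
rewrite unlock => hE.
have mG : measurable_fun setT (fun w => expR (z0 * `|e w| `^ gamma0)).
  apply: measurableT_comp => //; apply: measurable_funM => //.
  apply: (measurableT_comp (measurable_powR gamma0)).
  exact: measurableT_comp.
have iq : Pr.-integrable setT (EFin \o q).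
  apply: (@integrableZl _ _ _ Pr setT measurableT K
    (fun w => (expR (z0 * `|e w| `^ gamma0))%:E)).
  apply/integrableP; split; first exact/measurable_EFinP.
  by under eq_integral do rewrite gee0_abs ?lee_fin ?expR_ge0//.
have ie : Pr.-integrable setT (EFin \o e).
  apply: le_integrable iq => //; first exact/measurable_EFinP.
  move=> w _; rewrite /= lee_fin [leRHS]ger0_norm//.
  (* at z = 0 the domination reads 1 + e^2 <= q *)
  apply: le_trans (hK 0 gamma0 (e w) _ _); rewrite ?lexx ?g0 ?divr_ge0// ?ltW//.
  rewrite mul0r expR0 mulr1 -real_normK ?num_real//.
  have := sqr_ge0 (`|e w| - 1); have := normr_ge0 (e w); nra.
have finm := integrable_fin_num measurableT ie.
have finq := integrable_fin_num measurableT iq.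
exists (fine (\int[Pr]_w (e w)%:E)), (fine (\int[Pr]_w (q w)%:E)); split.
- by rewrite fineK.
- by apply: fine_ge0; apply: integral_ge0 => w _; rewrite lee_fin.
move=> z beta zz bb; have /andP[z_ge0 zz0] := zz; have /andP[b0 bg] := bb.
have b01 : 0 < beta <= 1 by rewrite b0 (le_trans bg).
have V0 y : 0 <= lyapunov z beta y by exact: expR_ge0.
have mV x : measurable_fun setT (fun w => (lyapunov z beta (x + e w))%:E).
  apply/measurable_EFinP; apply: (measurableT_comp (measurable_lyapunov z beta)).
  exact: measurable_funD.
have hq w : (1 + e w ^+ 2) * expR (z * `|e w| `^ beta) <= q w by exact: hK.
split=> [x|x x0].
  rewrite EFinM fineK// -integralZl//.
  apply: ge0_le_integral => //.
  - by move=> w _; rewrite lee_fin.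
  - by apply: measurable_funeM; exact: (measurable_int _ iq).
  - move=> w _; rewrite -EFinM lee_fin.
    apply: (le_trans (lyapunov_shift_le _ _ z_ge0 b01)).
    apply: ler_wpM2l => //; apply: le_trans (hq w).
    by rewrite ler_peMl ?expR_ge0// lerDl sqr_ge0.
pose c1 := z * beta * x `^ (beta - 1).
pose c2 := z * x `^ (beta - 2) + z ^+ 2 * x `^ (2 * beta - 2).
have c20 : 0 <= c2 by rewrite addr_ge0// mulr_ge0 ?sqr_ge0 ?powR_ge0.
have ib1 : Pr.-integrable setT (fun w => (c1%:E * (e w)%:E)%E).
  exact: integrableZl.
have ib2 : Pr.-integrable setT (fun w => (c2%:E * (q w)%:E)%E).
  exact: integrableZl.
have i1 : Pr.-integrable setT (fun w => 1%:E : \bar R).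
  exact: finite_measure_integrable_cst.
have i2 : Pr.-integrable setT (fun w => (1%:E + c1%:E * (e w)%:E)%E).
  exact: integrableD.
have i3 : Pr.-integrable setT
    (fun w => (1%:E + c1%:E * (e w)%:E + c2%:E * (q w)%:E)%E).
  exact: integrableD.
have -> : (lyapunov z beta x *
    (1 + drift_factor z beta (fine (\int[Pr]_w (e w)%:E))
      (fine (\int[Pr]_w (q w)%:E)) x))%:E =
    (\int[Pr]_w ((lyapunov z beta x)%:E *
      (1%:E + c1%:E * (e w)%:E + c2%:E * (q w)%:E)))%E.
  rewrite integralZl// integralD// integralD// !integralZl// integral_cst//.
  rewrite [X in (1 * X)%E](_ : _ = 1%E); last exact: probability_setT.
  rewrite mule1 -[in RHS](fineK finm) -[in RHS](fineK finq) -!EFinM.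
  by rewrite /drift_factor addrA.
apply: ge0_le_integral => //.
- by move=> w _; rewrite lee_fin.
- by apply: measurable_funeM; exact: (measurable_int _ i3).
- move=> w _; rewrite -!EFinM lee_fin.
  apply: (le_trans (lyapunov_drift_pointwise _ z_ge0 b01 x0)).
  apply: ler_wpM2l => //; rewrite /drift_factor addrA lerD2l; exact: ler_wpM2l.
Qed.

End moments.

(** * The drift condition *)

Section lyapunov_facts.
Context {R : realType}.
Implicit Types z beta x y : R.

Lemma lyapunov_ge1 z beta x : 0 <= z -> 1 <= lyapunov z beta x.
Proof. by move=> z0; rewrite -[leLHS]expR0 ler_expR mulr_ge0// powR_ge0. Qed.

Lemma lyapunov_le z beta x y : 0 <= z -> 0 <= beta -> x <= y ->
  lyapunov z beta x <= lyapunov z beta y.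
Proof.
move=> z0 b0 xy; rewrite ler_expR ler_wpM2l// ge0_ler_powR ?nnegrE//.
- by rewrite le_max lexx orbT.
- by rewrite le_max lexx orbT.
- by rewrite ge_max !le_max xy lexx orbT.
Qed.

Lemma lyapunov_nonpos z beta x : 0 < beta -> x <= 0 -> lyapunov z beta x = 1.
Proof.
by move=> b0 x0; rewrite /lyapunov max_r// powR0 ?gt_eqF// mulr0 expR0.
Qed.

Lemma lyapunov_unbounded z beta W : 0 < z -> 0 < beta ->
  exists x0 : R, forall x, x0 <= x -> W <= lyapunov z beta x.
Proof.
move=> z0 b0; pose W' := Num.max W 0.
have W'0 : 0 <= W' / z by rewrite divr_ge0 ?le_max ?lexx ?orbT// ltW.
exists ((W' / z) `^ beta^-1) => x xW.
have x0 : 0 <= x := le_trans (powR_ge0 _ _) xW.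
have h : W' / z <= x `^ beta.
  have -> : W' / z = ((W' / z) `^ beta^-1) `^ beta.
    by rewrite -powRrM mulVf ?gt_eqF// powRr1.
  by rewrite ge0_ler_powR ?nnegrE ?powR_ge0// ltW.
rewrite ler_pdivrMr// in h.
rewrite /lyapunov max_l//.
have := expR_ge1Dx (z * x `^ beta).
have : W <= W' by rewrite le_max lexx.
lra.
Qed.

(** As ln (V x) = z x^beta, the powers of z cancel and the rate at V x is
    delta V x x^(-tau). *)
Lemma rate_at_lyapunov (delta z beta tau x : R) : 0 < z -> 0 < beta -> 0 < x ->
  tau / beta + 2 <= z * x `^ beta -> 0 <= tau ->
  delta * z `^ (tau / beta) * lyapunov z beta x *
    Num.max 1 (ln (lyapunov z beta x)) `^ (- (tau / beta)) =
  delta * lyapunov z beta x * x `^ (- tau).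
Proof.
move=> z0 b0 x0 L t0.
have q0 : 0 <= tau / beta by rewrite divr_ge0// ltW.
rewrite {2}/lyapunov expRK [Num.max x 0]max_l ?(ltW x0)//.
rewrite [Num.max 1 _]max_r; last lra.
rewrite powRM ?powR_ge0 ?(ltW z0)// -powRrM.
rewrite (_ : beta * - (tau / beta) = - tau); last by field; rewrite gt_eqF.
rewrite (powRN z); field.
by rewrite gt_eqF// powR_gt0.
Qed.

Lemma drift_inequality_bounded (p v w K s t : R) :
  0 <= p < 1 -> 0 <= v <= w -> 0 <= K -> s <= t ->
  p * (v * K) + (1 - p) * K + s <= v + (w * K + K + t).
Proof.
move=> /andP[p0 /ltW p1] /andP[v0 vw] K0 st.
have h1 : p * (v * K) <= w * K.
  by rewrite (le_trans (ler_piMl (mulr_ge0 v0 K0) p1))// ler_wpM2r.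
have h2 : (1 - p) * K <= K by rewrite ler_piMl// gerBl.
lra.
Qed.

Lemma drift_inequality_large (p v K A r : R) :
  0 <= p < 1 -> 0 <= v -> 2 * K <= v ->
  p * (1 + A) + (1 - p) / 2 <= 1 - r ->
  p * (v * (1 + A)) + (1 - p) * K + v * r <= v.
Proof.
move=> /andP[_ /ltW p1] v0 Kv h.
have h1 := ler_wpM2l v0 h.
have h2 : (1 - p) * (2 * K) <= (1 - p) * v by rewrite ler_wpM2l// subr_ge0.
lra.
Qed.

End lyapunov_facts.

Theorem theorem3p5 (R : realType) (d : measure_display) (T : measurableType d)
    (Pr : probability T R) (eps U : nat -> {RV Pr >-> R})
    (z0 gamma0 : R) (hz0 : 0 < z0) (hgamma0 : 0 < gamma0 <= 1)
    (hnoise : noise_assumption eps U z0 gamma0)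
    (g : R -> R) (kappa cp cm R0 : R)
    (hkappa : 0 < kappa < 1) (hcp : 0 < cp) (hcm : cm < 1) (hR0 : 0 < R0)
    (hg : g_assumption g kappa cp cm R0)
    (P : R.-pker R ~> R) (hP : is_sur_kernel g (eps 0%N) P)
    (beta tau : R)
    (hbt : [\/ [/\ (0 < 'E_Pr[eps 0%N])%E,
                   beta = Num.min gamma0 (1 - kappa) & tau = kappa],
               [/\ ('E_Pr[eps 0%N] = 0)%E,
                   beta = Num.min gamma0 (1 - kappa / 2) & tau = kappa]
             | [/\ ('E_Pr[eps 0%N] < 0)%E,
                   beta = gamma0 & tau = Num.min (1 - gamma0) kappa]]) :
  exists (z delta M b : R) (phi : R -> R),
    [/\ 0 < z <= z0, 0 < delta, R0 <= M & 0 <= b] /\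
    [/\ forall v, 1 <= v -> 0 < phi v,
        concave_on `[1, +oo[ phi,
        {in `[1, +oo[ &, {homo phi : v w / v <= w}}
      & differentiable_on `[1, +oo[ phi] /\
    (\forall v \near +oo, phi v =
       delta * z `^ (tau / beta) * v * Num.max 1 (ln v) `^ (- (tau / beta))) /\
    (forall x : R,
       (\int[P x]_y (lyapunov z beta y)%:E + (phi (lyapunov z beta x))%:E <=
        (lyapunov z beta x + b * \1_(`]-oo, M]) x)%:E)%E).
Proof.
case: hnoise => _ hexp _ _ _.
case: hg => g01 _ gtail _.
have [m [K [Em K0 HK]]] := expectation_lyapunov_shift hz0 hgamma0 hexp.
have z20 : 0 < z0 / 2 by rewrite divr_gt0.
have hbt' : [\/ [/\ 0 < m, beta = Num.min gamma0 (1 - kappa) & tau = kappa],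
      [/\ m = 0, beta = Num.min gamma0 (1 - kappa / 2) & tau = kappa]
    | [/\ m < 0, beta = gamma0 & tau = Num.min (1 - gamma0) kappa]].
  move: hbt; rewrite Em lte_fin lte_fin.
  by case=> [[? ? ?]|[[?] ? ?]|[? ? ?]]; [apply: Or31|apply: Or32|apply: Or33].
have [bg t0 [z [delta [x0 [hz d0 drift]]]]] :=
  drift_cases z20 hgamma0 hkappa hcp K0 hbt'.
have /andP[z_gt0 z_le] := hz; have /andP[b0 _] := bg.
have z_ge0 := ltW z_gt0; have b_ge0 := ltW b0.
have zz : 0 <= z <= z0 / 2 by rewrite z_ge0.
have [bound shift] := HK z beta zz bg.
pose q := tau / beta.
have q0 : 0 <= q by rewrite divr_ge0.
have c0 : 0 < delta * z `^ q by rewrite mulr_gt0// powR_gt0.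
have [phi [phi_gt0 phi_concave phi_homo phi_diff phiE]] :=
  concave_rate_function c0 q0.
have [x1 V_large] :=
  lyapunov_unbounded (Num.max (2 * K) (expR (q + 2))) z_gt0 b0.
pose M := Num.max R0 (Num.max x0 x1).
pose V := lyapunov z beta.
have V1 x : 1 <= V x by exact: lyapunov_ge1.
have phi_le x y : x <= y -> phi (V x) <= phi (V y).
  move=> xy; have Vin t : V t \in `[1, +oo[ by rewrite in_itv/= V1.
  by apply: phi_homo; [exact: Vin|exact: Vin|exact: lyapunov_le].
have mV : measurable_fun setT V by exact: measurable_lyapunov.
have V00 : V 0 = 1 by rewrite /V lyapunov_nonpos.
(* a restart is a move from 0, where V = 1, so its mean is at most K *)
have PV x B : (\int[Pr]_w (V (x + eps 0%N w))%:E <= B%:E)%E ->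
    (\int[P x]_y (V y)%:E <= (g x * B + (1 - g x) * K)%:E)%E.
  have /andP[gx0 /ltW gx1] := g01 x => hB.
  have V_ge0 y : 0 <= V y by exact: expR_ge0.
  rewrite (integral_sur_kernel hP _ mV V_ge0) ?gx0//.
  rewrite [leRHS]EFinD !EFinM leeD// lee_wpmul2l ?lee_fin ?subr_ge0//.
  have := bound 0; rewrite -/V V00 mul1r.
  by under eq_integral do rewrite add0r.
pose b := V M * K + K + phi (V M).
have b_ge0' : 0 <= b.
  by rewrite !addr_ge0 ?mulr_ge0 ?expR_ge0// ltW// phi_gt0// V1.
exists z, delta, M, b, phi; split; first split => //.
- by rewrite z_gt0/=; lra.
- by rewrite le_max lexx.
split; first by split.
split; first by near=> v; apply: phiE; near: v; exact: nbhs_pinfty_ge.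
move=> x; have /andP[gx0 gx1] := g01 x.
have [xM|Mx] := leP x M.
  rewrite indicE mem_set ?mulr1; last by rewrite /= in_itv.
  apply: (@le_trans _ _
    ((g x * (V x * K) + (1 - g x) * K)%:E + (phi (V x))%:E)%E).
    by rewrite leeD2r//; apply: PV; exact: bound.
  rewrite -EFinD lee_fin /b.
  apply: drift_inequality_bounded => //; last exact: phi_le.
  by rewrite expR_ge0/= /V lyapunov_le.
rewrite indicE memNset ?mulr0 ?addr0; last by rewrite /= in_itv/= leNgt Mx.
have RM : R0 <= M by rewrite le_max lexx.
have xM0 : x0 <= M by rewrite !le_max lexx !orbT.
have xM1 : x1 <= M by rewrite !le_max lexx !orbT.
have RX : R0 <= x := le_trans RM (ltW Mx).
have xp : 0 < x := lt_le_trans hR0 RX.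
have := V_large x (le_trans xM1 (ltW Mx)); rewrite ge_max => /andP[VK Vq].
have phiV : phi (V x) = delta * V x * x `^ (- tau).
  rewrite phiE// rate_at_lyapunov//.
  by rewrite /lyapunov max_l ?(ltW xp)// ler_expR in Vq.
have hdrift := drift x (g x) (le_trans xM0 (ltW Mx)) (g01 x) (gtail x RX).
apply: (@le_trans _ _ ((g x * (V x * (1 + drift_factor z beta m K x)) +
    (1 - g x) * K)%:E + (phi (V x))%:E)%E).
  by rewrite leeD2r//; apply: PV; exact: shift.
rewrite -EFinD lee_fin phiV [delta * _]mulrC -mulrA.
by apply: drift_inequality_large => //; exact: expR_ge0.
Unshelve. all: by end_near. Qed.
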